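(* Let $A=(a_{i,j})\in\mathbb{C}^{n\times n}$ have eigenvalues $\lambda_1,\dots,\lambda_n$ with $|\lambda_1|\geq\dots\geq|\lambda_n|$, and let $\gamma_1\geq\dots\geq\gamma_n$ be the tropical eigenvalues of $A$. Let $k\in[n]$ be a saturated index for the tropical characteristic polynomial $q_{|A|}$. Suppose that among the subsets of $[n]$ of cardinality $k$ there is a unique subset $\overline{I}_k$ for which there exists a (possibly not unique) permutation $\overline\sigma\in S_{\overline{I}_k}$ that realizes the maximum $$\max_{I\subset[n],\,\#I=k}\ \max_{\sigma\in S_I}\ \prod_{i\in I}|a_{i,\sigma(i)}|$$ (that is, $w_{|A|}(\overline\sigma)=\mathrm{tr}^k_{\mathbb{T}}|A|$). Suppose $\det A[\overline{I}_k,\overline{I}_k]\neq0$. Finally suppose that, for any permutation $\sigma$ of any subset of $[n]$ of cardinality $k$ other than $\overline{I}_k$, one has $w_{|A|}(\sigma)\leq\delta_k\,w_{|A|}(\overline\sigma)=\delta_k\,\mathrm{tr}^k_{\mathbb{T}}|A|$, where $\delta_k$ is a real number with $$\delta_k<\frac{|\det A[\overline{I}_k,\overline{I}_k]|}{\mathrm{tr}^k_{\mathbb{T}}|A|\left(\binom nk-1\right)k!}$$ (this last bound being void when $k=n$). Then $$L_k\,\gamma_1\cdots\gamma_k\leq|\lambda_1\cdots\lambda_k|$$ holds with $$L_k=\frac1{\binom nk}\left(\frac{|\det A[\overline{I}_k,\overline{I}_k]|}{\mathrm{tr}^k_{\mathbb{T}}|A|}-\delta_k\left(\binom nk-1\r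ight)k!\right).$$
   Context: Notation: $[n]=\{1,\dots,n\}$; $S_I$ is the set of permutations of $I$; $A[I,J]$ is the submatrix with rows in $I$ and columns in $J$; $|A|=(|a_{i,j}|)$; for a permutation $\sigma$ of $I\subset[n]$, $w_{|A|}(\sigma)=\prod_{i\in I}|a_{i,\sigma(i)}|$. Tropical eigenvalues: for an $n\times n$ nonnegative matrix $M=(m_{i,j})$, put $\mathrm{tr}^0_{\mathbb{T}}M=1$ and, for $k\in[n]$, $\mathrm{tr}^k_{\mathbb{T}}M=\max_{I\subset[n],\,\#I=k}\ \max_{\sigma\in S_I}\prod_{i\in I}m_{i,\sigma(i)}$. The tropical characteristic polynomial $q_M$ is the formal max-times polynomial whose coefficient of $X^{n-k}$ is $\mathrm{tr}^k_{\mathbb{T}}M$ ($0\leq k\leq n$); its polynomial function is $q_M(x)=\max_{0\leq k\leq n}(\mathrm{tr}^k_{\mathbb{T}}M)\,x^{n-k}$, $x\geq0$. It factors uniquely as $q_M(x)=\prod_{i=1}^n\max(x,\gamma_i)$ with $\gamma_1\geq\dots\geq\gamma_n\geq0$; the $\gamma_i$ (tropical roots of $q_M$ with multiplicities) are the tropical eigenvalues of $M$. The tropical eigenvalues of a complex matrix $A$ are those of $|A|$. Saturated index: for $0\le k\le n$ let $\widehat{\mathrm{tr}}^k_{\mathbb{T}}|A|=\exp(f(k))$, where $f:\mathbb{R}\to[-\infty,\infty)$ is the smallest upper semicontinuous concave function with $f(j)\geq\log(\mathrm{tr}^j_{\mathbb{T}}|A|)$ for all $0\leq j\leq n$ (with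 $\log0=-\infty$, $\exp(-\infty)=0$). The index $k$ is saturated for $q_{|A|}$ if $\widehat{\mathrm{tr}}^k_{\mathbb{T}}|A|=\mathrm{tr}^k_{\mathbb{T}}|A|$, i.e. the coefficient of $X^{n-k}$ in $q_{|A|}$ equals its log-concavified value. *)

(* Defs.v *)
From mathcomp Require Import all_boot all_order all_algebra all_fingroup.
From mathcomp Require Import complex.
From mathcomp Require Import all_classical all_reals all_analysis.
Import Order.TTheory GRing.Theory Num.Theory.
Import numFieldNormedType.Exports.

Set Implicit Arguments.
Unset Strict Implicit.
Unset Printing Implicit Defensive.

Local Open Scope ring_scope.

(* |z| as an element of R; the norm `|z| of R[i] is the same number, but
   embedded in R[i]. *)
Definition cmod (R : realType) (z : R[i]) : R := complex.Re `|z|.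

Definition cmod_mx (R : realType) (n : nat) (A : 'M[R[i]]_n) : 'M[R]_n :=
  map_mx (@cmod R) A.

Definition submatrix (T : Type) (n : nat) (A : 'M[T]_n) (I J : {set 'I_n}) :
    'M[T]_(#|I|, #|J|) :=
  mxsub (fun i : 'I_#|I| => enum_val i) (fun j : 'I_#|J| => enum_val j) A.

(* A permutation of the subset I is encoded as a permutation s of the whole
   index set with perm_on I s, that is, fixing every point outside I. *)
Definition perm_weight (R : realType) (n : nat) (M : 'M[R]_n)
    (I : {set 'I_n}) (s : {perm 'I_n}) : R :=
  \prod_(i in I) M i (s i).

(* The maxima below are over nonnegative numbers whenever the entries of M and
   the argument x are nonnegative, so starting them from 0 is harmless. *)
Definition trop_trace (R : realType) (n : nat) (M : 'M[R]_n) (k : nat) : R :=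
  \big[Num.max/0]_(I : {set 'I_n} | #|I| == k)
    \big[Num.max/0]_(s : {perm 'I_n} | perm_on I s) perm_weight M I s.

Lemma trop_trace0 (R : realType) (n : nat) (M : 'M[R]_n) : trop_trace M 0 = 1.
Proof.
have w1 s : perm_weight M finset.set0 s = 1.
  by rewrite /perm_weight finset.big_set0.
apply/eqP; rewrite eq_le; apply/andP; split.
  apply: bigmax_le => // I; rewrite cards_eq0 => /eqP ->.
  by apply: bigmax_le => // s _; rewrite w1.
apply: (bigmax_sup finset.set0); first by rewrite cards0.
by apply: (bigmax_sup 1%g); rewrite ?perm_on1 ?w1.
Qed.

(* The polynomial function of the tropical characteristic polynomial; its formal
   coefficient of X^(n-k) is trop_trace M k, which the function does not
   determine unless k is saturated. *)
Definition trop_char_poly (R : realType) (n : nat) (M : 'M[R]_n) (x : R) : R :=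
  \big[Num.max/0]_(k < n.+1) (trop_trace M k * x ^+ (n - k)).

Definition trop_eigenvalues (R : realType) (n : nat) (M : 'M[R]_n)
    (gamma : 'I_n -> R) : Prop :=
  [/\ forall i, 0 <= gamma i,
      forall i j : 'I_n, (i <= j)%N -> gamma j <= gamma i
    & forall x, 0 <= x ->
        trop_char_poly M x = \prod_(i < n) Num.max x (gamma i)].

(* Eigenvalues listed with algebraic multiplicity, by decreasing modulus. *)
Definition ordered_eigenvalues (R : realType) (n : nat) (A : 'M[R[i]]_n)
    (lambda : 'I_n -> R[i]) : Prop :=
  char_poly A = \prod_(i < n) ('X - (lambda i)%:P) /\
  forall i j : 'I_n, (i <= j)%N -> cmod (lambda j) <= cmod (lambda i).

Local Open Scope ereal_scope.

(* Endpoints t = 0, 1 are covered by the convention 0 * -oo = 0. *)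
Definition concave_ereal (R : realType) (f : R -> \bar R) : Prop :=
  forall (x y t : R), (0 <= t <= 1)%R ->
    (1 - t)%:E * f x + t%:E * f y <= f ((1 - t) * x + t * y)%R.

Definition upper_semicontinuous (R : realType) (f : R -> \bar R) : Prop :=
  lower_semicontinuous (fun x => - f x).

(* lne is the logarithm on [0, +oo] with lne 0 = -oo. *)
Definition usc_concave_log_majorant (R : realType) (n : nat) (c : nat -> R)
    (f : R -> \bar R) : Prop :=
  [/\ forall x, f x < +oo,
      upper_semicontinuous f,
      concave_ereal f
    & forall j : nat, (j <= n)%N -> lne (c j)%:E <= f j%:R].

Definition log_concave_hull (R : realType) (n : nat) (c : nat -> R)
    (f : R -> \bar R) : Prop :=
  usc_concave_log_majorant n c f /\
  forall g, usc_concave_log_majorant n c g -> forall x, f x <= g x.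

Lemma log_concave_hull_unique (R : realType) (n : nat) (c : nat -> R) f g :
  log_concave_hull n c f -> log_concave_hull n c g -> f = g.
Proof.
move=> [mf lf] [mg lg]; apply/funext => x.
by apply/eqP; rewrite eq_le lf// lg.
Qed.

Lemma log_concave_hull_exists (R : realType) (n : nat) (c : nat -> R) :
  exists f, log_concave_hull n c f.
Proof.
pose m := usc_concave_log_majorant n c.
pose B : R := (\sum_(j < n.+1) `|c j|)%R.
have mB : m (cst B%:E).
  split => [x|x a aB|x y t /andP[t0 t1]|j jn] /=.
  - exact: ltry.
  - by exists setT; [exact: filterT|move=> y _].
  - by rewrite -!EFinM -EFinD lee_fin -mulrDl subrK mul1r.
  - have cB : (c j <= B)%R.
      rewrite /B (bigD1 (Ordinal (jn : (j < n.+1)%N)))//=.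
      by rewrite (le_trans (ler_norm _))// lerDl sumr_ge0.
    case: ifPn => [_|]; first exact: leNye.
    by rewrite -ltNge => c0; rewrite lee_fin (le_trans _ cB)// ltW// ln_sublinear.
exists (fun x => ereal_inf [set f x | f in m]); split; last first.
  by move=> g mg x; apply: ereal_inf_lbound; exists g.
split => [x|x a|x y t t01|j jn].
- by apply: (@le_lt_trans _ _ B%:E); [apply: ereal_inf_lbound; exists (cst B%:E)|exact: ltry].
- rewrite lteNr => /ereal_inf_lt[_ [g mg <-]] ga.
  have [_ uscg _ _] := mg.
  have [|V xV Vg] := uscg x a; first by rewrite lteNr.
  exists V => // y /Vg; rewrite lteNr => /(le_lt_trans _) h.
  by rewrite lteNr; apply: h; apply: ereal_inf_lbound; exists g.
- apply: le_ereal_inf_tmp => _ [g mg <-]; have [_ _ cg _] := mg.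
  apply: (le_trans _ (cg x y t t01)); case/andP: t01 => t0 t1.
  apply: leeD; (apply: lee_wpmul2l; first by rewrite lee_fin ?subr_ge0);
    by apply: ereal_inf_lbound; exists g.
- by apply: le_ereal_inf_tmp => _ [g [_ _ _ cg] <-]; exact: cg.
Qed.

(* The hull f exists and is unique by the two lemmas above, so the existential
   only serves to name it. *)
Definition saturated (R : realType) (n : nat) (M : 'M[R]_n) (k : nat) : Prop :=
  exists f : R -> \bar R,
    log_concave_hull n (trop_trace M) f /\
    expeR (f k%:R) = (trop_trace M k)%:E.

Local Close Scope ereal_scope.

Definition attains_trop_trace (R : realType) (n : nat) (M : 'M[R]_n) (k : nat)
    (I : {set 'I_n}) : Prop :=
  #|I| = k /\
  exists2 s : {perm 'I_n}, perm_on I s & perm_weight M I s = trop_trace M k.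

(* Main.v *)
(* The elementary symmetric function e_k of the eigenvalues is, up to sign, a
   coefficient of the characteristic polynomial, hence equals the sum of the
   principal k-minors of A. On one side
   |e_k| <= 'C(n, k) |lambda_1 ... lambda_k|. On the other side the minor
   indexed by I dominates the sum, because every other principal k-minor is at
   most k! delta tr^k. Finally saturation gives gamma_1 ... gamma_k <= tr^k: let
   t = gamma_k > 0. At the critical indices
   u = #{gamma > t} < k <= v = #{gamma >= t} one has tr^j = gamma_1 ... gamma_j,
   as the tropical polynomial is a monomial on an interval on either side of t,
   and concavity of the hull interpolates between u and v. *)
Require Import Defs.
From mathcomp Require Import all_boot all_order all_algebra all_fingroup.
From mathcomp Require Import complex.
From mathcomp Require Import all_classical all_reals all_analysis.
Import Order.TTheory GRing.Theory Num.Theory.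

Set Implicit Arguments.
Unset Strict Implicit.
Unset Printing Implicit Defensive.

Local Open Scope ring_scope.

(** * Principal minors and coefficients of the characteristic polynomial *)

(** Sylvester's identity: both sides are the determinant of the block matrix with rows [1, -U] and
    [V, 1], made block triangular by a unitriangular factor on the right. *)
Lemma det_1Dmulmx_comm (R : comPzRingType) (m n : nat) (U : 'M[R]_(m, n))
    (V : 'M[R]_(n, m)) :
  \det (1%:M + U *m V) = \det (1%:M + V *m U).
Proof.
have E1 : \det (1%:M + V *m U) = \det (block_mx 1%:M (- U) V 1%:M).
  rewrite -[RHS]mulr1 -[X in _ * X](_ : \det (block_mx 1%:M U 0 1%:M) = 1);
    last first.
    by rewrite det_ublock !det1 mulr1.
  rewrite -det_mulmx mulmx_block !mulmx1 !mulmx0 !mul1mx !addr0 subrr.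
  by rewrite det_lblock det1 mul1r addrC.
rewrite E1 -[RHS]mulr1 -[X in _ * X](_ : \det (block_mx 1%:M 0 (- V) 1%:M) = 1);
  last first.
  by rewrite det_lblock !det1 mulr1.
rewrite -det_mulmx mulmx_block !mulmx1 !mulmx0 !mul1mx !add0r subrr.
by rewrite det_ublock det1 mulr1 mulNmx mulmxN opprK.
Qed.

(** When the product is expanded, [J] is the set of factors contributing their constant term. Both
    expansions of the characteristic polynomial below rest on this. *)
Lemma coef_prod_affine (R : comNzRingType) (n k : nat) (a b : 'I_n -> R) :
  (k <= n)%N ->
  (\prod_(i < n) ((a i)%:P + b i *: 'X))`_(n - k) =
  \sum_(J : {set 'I_n} | #|J| == k)
    (\prod_(i in J) a i) * (\prod_(i in ~: J) b i).
Proof.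
move=> kn; rewrite bigA_distr coef_sum big_mkcond [RHS]big_mkcond /=.
apply: eq_bigr => J _.
have Jn : (#|J| <= n)%N by rewrite -[X in (_ <= X)%N]card_ord max_card.
have -> : \prod_i (if i \in J then (a i)%:P else b i *: 'X) =
    ((\prod_(i in J) a i) * (\prod_(i in ~: J) b i)) *: 'X^(n - #|J|).
  rewrite (bigID (mem J)) /= -scalerA (_ : (n - #|J|)%N = #|~: J|); last first.
    by rewrite (cardsCs (~: J)) finset.setCK card_ord.
  rewrite (eq_bigr (fun i => (a i)%:P)); last by move=> i ->.
  rewrite -rmorph_prod mul_polyC; congr (_ *: _).
  rewrite [X in X = _](eq_bigr (fun i => b i *: 'X)); last first.
    by move=> i /negPf ->.
  rewrite scaler_prod prodr_const -cardsE.
  by congr (_ *: 'X^_); apply: eq_bigl => i; rewrite finset.in_setC.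
rewrite coefZ coefXn eqn_sub2lE// eq_sym.
by case: eqP => _; rewrite ?mulr1 ?mulr0.
Qed.

(** The Leibniz formula with permutations of [J] extended by the identity, so that no enumeration of
    [J] enters. *)
Definition principal_minor (R : comNzRingType) (n : nat) (A : 'M[R]_n)
    (J : {set 'I_n}) : R :=
  \sum_(s : {perm 'I_n} | perm_on J s) (-1) ^+ s * \prod_(i in J) A i (s i).

Lemma prod_perm_fixed (R : comNzRingType) (n : nat) (J : {set 'I_n})
    (s : {perm 'I_n}) :
  \prod_(i in ~: J) ((i == s i)%:R : R) = (perm_on J s)%:R.
Proof.
have [i|sJ] := pickP [pred i | (i \notin J) && (s i != i)].
  move=> /andP[iJ si]; rewrite (bigD1 i) ?finset.in_setC//=.
  rewrite eq_sym (negPf si) mul0r.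
  by case: (boolP (perm_on J s)) si => // /out_perm ->; rewrite ?eqxx.
have pJ : perm_on J s.
  apply/fintype.subsetP => i; rewrite inE; have := sJ i => /=.
  by case: (i \in J) => //= ->.
rewrite pJ big1// => i; rewrite finset.in_setC => /(out_perm pJ) ->.
by rewrite eqxx.
Qed.

(* With E the 0-1 matrix selecting the rows in J, the left-hand side is
   det (1 + E (A - 1) E^T), and moving E^T to the front turns it into the
   determinant of A with each row outside J replaced by that of 1. *)
Lemma det_submatrix (R : comNzRingType) (n : nat) (A : 'M[R]_n)
    (J : {set 'I_n}) :
  \det (submatrix A J J) = principal_minor A J.
Proof.
pose E := \matrix_(i < #|J|, j < n) ((enum_val i == j)%:R : R).
have EM (B : 'M[R]_n) i j : (E *m B) i j = B (enum_val i) j.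
  rewrite !mxE (bigD1 (enum_val i))//= !mxE eqxx mul1r big1 ?addr0// => l li.
  by rewrite mxE eq_sym (negPf li) mul0r.
have ET l i : E^T l i = (enum_val i == l)%:R by rewrite !mxE.
have ETE i : (E *m (A - 1%:M) *m E^T) i =1
    fun j => (A - 1%:M) (enum_val i) (enum_val j).
  move=> j; rewrite mxE (bigD1 (enum_val j))//= EM ET eqxx mulr1.
  by rewrite big1 ?addr0// => l li; rewrite ET eq_sym (negPf li) mulr0.
have -> : submatrix A J J = 1%:M + E *m (A - 1%:M) *m E^T.
  apply/matrixP => i j; rewrite [RHS]mxE ETE !mxE (inj_eq enum_val_inj).
  by rewrite addrC subrK.
rewrite det_1Dmulmx_comm; set B := (1%:M + _).
have BE i j : B i j = if i \in J then A i j else (i == j)%:R.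
  rewrite /B mxE [X in _ + X]mxE (eq_bigr (fun l : 'I_#|J| =>
      (i == enum_val l)%:R * (A - 1%:M) i j)); last first.
    move=> l _; rewrite EM ET [enum_val l == i]eq_sym.
    by case: eqVneq => [<-//|_]; rewrite !mul0r.
  rewrite -mulr_suml; case: ifPn => iJ.
    rewrite (bigD1 (enum_rank_in iJ i))//= enum_rankK_in// eqxx big1 ?addr0.
      by rewrite mul1r !mxE addrC subrK.
    move=> l li; case: eqP => // il; case/eqP: li.
    by apply: enum_val_inj; rewrite enum_rankK_in.
  rewrite big1 ?mul0r ?addr0 ?mxE// => l _.
  by case: eqP iJ => // ->; rewrite enum_valP.
rewrite /principal_minor [RHS]big_mkcond; apply: eq_bigr => s _.
rewrite (bigID (mem J)) /= (eq_bigr (fun i => A i (s i))); last first.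
  by move=> i iJ; rewrite BE iJ.
rewrite [X in _ * (_ * X)](_ : _ = (perm_on J s)%:R); last first.
  rewrite -prod_perm_fixed; apply: eq_big => i; first by rewrite finset.in_setC.
  by move=> iJ; rewrite BE (negPf iJ).
by case: ifP => _; rewrite ?mulr1// !mulr0.
Qed.

(** Each Leibniz term is a product of affine factors; its coefficient is a sum over [J] that
    vanishes unless the permutation fixes the complement of [J]. Exchanging the sums collects the
    minors. *)
Lemma coef_char_poly (R : comNzRingType) (n k : nat) (A : 'M[R]_n) :
  (k <= n)%N ->
  (char_poly A)`_(n - k) =
  (-1) ^+ k * \sum_(J : {set 'I_n} | #|J| == k) principal_minor A J.
Proof.
move=> kn; rewrite /char_poly /determinant coef_sum.
under eq_bigr => s _.
  rewrite (eq_bigr (fun i => (- A i (s i))%:P + (i == s i)%:R *: 'X));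
    last first.
    by move=> i _; rewrite !mxE polyCN addrC scaler_nat.
  rewrite -(rmorph_sign polyC) mul_polyC coefZ.
  rewrite coef_prod_affine// mulr_sumr.
  under eq_bigr => J /eqP Jk.
    rewrite prodrN prod_perm_fixed Jk.
  over.
over.
rewrite exchange_big /= mulr_sumr; apply: eq_bigr => J _.
rewrite /principal_minor mulr_sumr [RHS]big_mkcond; apply: eq_bigr => s _.
by case: (perm_on J s); rewrite ?mulr0// mulr1 mulrCA.
Qed.

Lemma coef_prod_XsubC_sum (R : comNzRingType) (n k : nat) (lambda : 'I_n -> R) :
  (k <= n)%N ->
  (\prod_(i < n) ('X - (lambda i)%:P))`_(n - k) =
  (-1) ^+ k * \sum_(J : {set 'I_n} | #|J| == k) \prod_(i in J) lambda i.
Proof.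
move=> kn; rewrite (eq_bigr (fun i => (- lambda i)%:P + 1 *: 'X)); last first.
  by move=> i _; rewrite polyCN addrC scale1r.
rewrite coef_prod_affine// mulr_sumr; apply: eq_bigr => J /eqP Jk.
by rewrite prodrN Jk [X in _ * X]big1 ?mulr1.
Qed.

(** * Complex moduli as real numbers *)

Section ComplexModulus.
Variable R : realType.
Implicit Types z w : R[i].

Lemma cmodE z : (cmod z)%:C%C = `|z|.
Proof. by rewrite /cmod normc_def. Qed.

Lemma cmod_ge0 z : 0 <= cmod z.
Proof. by rewrite -ler0c cmodE. Qed.

Lemma cmod_prod (T : finType) (P : pred T) (F : T -> R[i]) :
  cmod (\prod_(i | P i) F i) = \prod_(i | P i) cmod (F i).
Proof.
apply: complexI; rewrite cmodE normr_prod rmorph_prod /=.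
by apply: eq_bigr => i _; rewrite cmodE.
Qed.

Lemma cmod_signM (m : nat) z : cmod ((-1) ^+ m * z) = cmod z.
Proof. by apply: complexI; rewrite !cmodE normrMsign. Qed.

Lemma cmod_sum (T : finType) (P : pred T) (F : T -> R[i]) :
  cmod (\sum_(i | P i) F i) <= \sum_(i | P i) cmod (F i).
Proof.
rewrite -lecR cmodE rmorph_sum /= (eq_bigr _ (fun _ _ => cmodE _)).
exact: ler_norm_sum.
Qed.

Lemma cmodD z w : cmod (z + w) <= cmod z + cmod w.
Proof. by rewrite -lecR cmodE rmorphD /= !cmodE ler_normD. Qed.

Lemma cmodN z : cmod (- z) = cmod z.
Proof. by apply: complexI; rewrite !cmodE normrN. Qed.

(** The Leibniz sum has one term per permutation of [J], with modulus its weight. *)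
Lemma cmod_principal_minor_le (n : nat) (A : 'M[R[i]]_n) (J : {set 'I_n})
    (w : R) :
  (forall s, perm_on J s -> perm_weight (cmod_mx A) J s <= w) ->
  cmod (principal_minor A J) <= w * ((#|J|)`!)%:R.
Proof.
move=> wJ; rewrite (le_trans (cmod_sum _ _))//.
rewrite -card_perm mulr_natr -sumr_const ler_sum// => s sJ.
rewrite cmod_signM cmod_prod (le_trans _ (wJ s sJ))// /perm_weight.
by rewrite ler_prod// => i _; rewrite cmod_ge0 mxE lexx.
Qed.

End ComplexModulus.

(** * Products over a decreasing sequence *)

Lemma card_ord_lt (n k : nat) :
  (k <= n)%N -> #|[set i : 'I_n | (i < k)%N]| = k.
Proof.
move=> kn; rewrite -sum1_card (eq_bigl (fun i : 'I_n => (i < k)%N)); last first.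
  by move=> i; rewrite inE.
by rewrite (big_ord_narrow kn) sum1_card card_ord.
Qed.

(** Exchange argument: off their intersection, [J] and the initial segment [K] have equally many
    indices, and the last value [t] on [K] bounds the former values from above and the latter from
    below. *)
Lemma prod_decreasing_le (R : numDomainType) (n : nat) (mu : 'I_n -> R)
    (J : {set 'I_n}) :
  (forall i, 0 <= mu i) ->
  (forall i j : 'I_n, (i <= j)%N -> mu j <= mu i) ->
  \prod_(i in J) mu i <= \prod_(i < n | (i < #|J|)%N) mu i.
Proof.
move=> mu0 muP; pose K := [set i : 'I_n | (i < #|J|)%N].
have KE i : (i \in K) = (i < #|J|)%N by rewrite /K inE.
have Jn : (#|J| <= n)%N by rewrite -[X in (_ <= X)%N]card_ord max_card.
rewrite -(eq_bigl _ _ KE).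
have [J0|J0] := posnP #|J|.
  rewrite [leRHS]big_pred0; last by move=> i; rewrite KE J0.
  by rewrite (cards0_eq J0) big_set0.
have Jn' : (#|J|.-1 < n)%N by rewrite prednK.
pose t := mu (Ordinal Jn').
have cK : #|K :\: J| = #|J :\: K|.
  by rewrite !cardsD card_ord_lt// finset.setIC.
rewrite [leLHS](big_setID K) [leRHS](big_setID J) finset.setIC /=.
apply: ler_wpM2l; first by rewrite prodr_ge0.
apply: (@le_trans _ _ (t ^+ #|J :\: K|)).
  rewrite -prodr_const ler_prod// => i.
  rewrite finset.in_setD KE -leqNgt => /andP[Ji _].
  by rewrite mu0 muP//= (leq_trans (leq_pred _)).
rewrite -cK -prodr_const ler_prod// => i.
rewrite finset.in_setD KE => /andP[_ iJ].
by rewrite mu0 muP//= -ltnS prednK.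
Qed.

(** * Tropical traces at the critical indices *)

Section TropicalRoots.
Variables (R : realType) (n : nat) (M : 'M[R]_n).
Implicit Types (gamma : 'I_n -> R) (W : {set 'I_n}).

Lemma trop_trace_ge0 (k : nat) : 0 <= trop_trace M k.
Proof. exact: bigmax_ge_id. Qed.

Lemma perm_weight_le_trop_trace (J : {set 'I_n}) (s : {perm 'I_n}) :
  perm_on J s -> perm_weight M J s <= trop_trace M #|J|.
Proof.
move=> sJ; apply: (bigmax_sup J); first by rewrite eqxx.
exact: (bigmax_sup s).
Qed.

Lemma trop_char_poly_ge (j : nat) (x : R) :
  (j <= n)%N -> trop_trace M j * x ^+ (n - j) <= trop_char_poly M x.
Proof. by move=> jn; apply: (bigmax_sup (inord j)); rewrite ?inordK. Qed.

Lemma trop_char_poly_attained (x : R) :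
  0 <= x ->
  exists2 j, (j <= n)%N & trop_char_poly M x = trop_trace M j * x ^+ (n - j).
Proof.
move=> x0; rewrite /trop_char_poly.
have [||j _ ->] := @eq_bigmax _ R 'I_n.+1 0 ord0 xpredT
  (fun k => trop_trace M k * x ^+ (n - k)) => //.
  by move=> k _; rewrite mulr_ge0 ?exprn_ge0 ?trop_trace_ge0.
by exists j => //; rewrite -ltnS.
Qed.

Lemma exp_cross_le (x y : R) (d e : nat) :
  0 < x -> x < y -> x ^+ d * y ^+ e <= y ^+ d * x ^+ e -> (e <= d)%N.
Proof.
move=> x0 xy; have y0 := lt_trans x0 xy; rewrite leqNgt => le_xy.
apply/negP => de; move: le_xy; rewrite -(subnK (ltnW de)) !exprD.
rewrite mulrCA [leRHS]mulrCA [y ^+ d * x ^+ d]mulrC.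
rewrite ler_pM2r ?mulr_gt0 ?exprn_gt0// leNgt ltrXn2r ?ltW//.
by rewrite subn_eq0 -ltnNge de.
Qed.

(** The term attaining the maximum at the interior point [m] stays below the monomial on the
    interval and touches it at [m]. Comparison at [b] and at [a] forces equal exponents, hence equal
    coefficients. *)
Lemma trop_trace_of_monomial (a b c : R) (i : nat) :
  0 < a -> a < b -> 0 < c -> (i <= n)%N ->
  (forall x, a <= x <= b -> trop_char_poly M x = c * x ^+ (n - i)) ->
  trop_trace M i = c.
Proof.
move=> a0 ab c0 ni pE; pose m := (a + b) / 2.
have [am mb] : a < m /\ m < b by rewrite midf_lt// midf_lt.
have m0 := lt_trans a0 am.
have [j jn] := trop_char_poly_attained (ltW m0).
rewrite pE ?(ltW am) ?ltW// => cE.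
(* The equality at [m] eliminates [trop_trace M j] from the inequality at [y]. *)
have cross y : a <= y <= b ->
    m ^+ (n - i) * y ^+ (n - j) <= y ^+ (n - i) * m ^+ (n - j).
  move=> yab; have := trop_char_poly_ge y jn; rewrite pE// => le_y.
  have mj0 : 0 <= m ^+ (n - j) by rewrite exprn_ge0// ltW.
  rewrite -(ler_pM2l c0) mulrA cE mulrAC mulrA.
  exact: ler_wpM2r.
have ji : (n - j <= n - i)%N.
  by apply: (exp_cross_le m0 mb); apply: cross; rewrite (ltW ab) lexx.
have ij : (n - i <= n - j)%N.
  apply: (exp_cross_le a0 am); rewrite mulrC [leRHS]mulrC.
  by apply: cross; rewrite (ltW ab) lexx.
have eij : i = j by apply/eqP; rewrite -(eqn_sub2lE ni jn) eqn_leq ij ji.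
by move: cE; rewrite eij => /mulIf ->//; rewrite expf_neq0// gt_eqF.
Qed.

(** On [[a, b]] the maximum of [x] and [gamma i] is [gamma i] for [i] in [W] and [x] otherwise, so
    the tropical polynomial is a monomial there. *)
Lemma trop_trace_gap gamma W (a b : R) :
  trop_eigenvalues M gamma -> 0 < a -> a < b ->
  (forall i, i \in W -> b <= gamma i) ->
  (forall i, i \notin W -> gamma i <= a) ->
  trop_trace M #|W| = \prod_(i in W) gamma i.
Proof.
move=> [_ _ pE] a0 ab bW aW.
apply: (trop_trace_of_monomial a0 ab).
- by apply: prodr_gt0 => i /bW; apply: lt_le_trans; apply: lt_trans ab.
- by rewrite -[X in (_ <= X)%N]card_ord max_card.
move=> x /andP[ax xb]; rewrite pE; last by rewrite (le_trans _ ax)// ltW.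
rewrite (bigID (fun i => i \in W)) /=; congr (_ * _).
  by apply: eq_bigr => i /bW bi; apply/max_idPr; exact: le_trans bi.
rewrite (eq_bigr (fun=> x)); last first.
  by move=> i /aW ai; apply/max_idPl; exact: le_trans ai _.
rewrite prodr_const; congr (x ^+ _).
rewrite -[X in (X - _)%N]card_ord -(cardsC W) addKn.
by apply: eq_card => i; rewrite finset.in_setC.
Qed.

Lemma trop_trace_gt gamma (t : R) :
  trop_eigenvalues M gamma -> 0 < t ->
  trop_trace M #|[set i | t < gamma i]| = \prod_(i | t < gamma i) gamma i.
Proof.
(* Right end of a gap above [t]; the default [t + 1] covers the case where no root exceeds [t]. *)
move=> hg t0; pose b := \big[Num.min/t + 1]_(i | t < gamma i) gamma i.
rewrite (@trop_trace_gap gamma [set i | t < gamma i] t b)//.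
- by apply: eq_bigl => i; rewrite inE.
- by rewrite lt_bigmin// ltrDl.
- by move=> i; rewrite inE; exact: bigmin_le_cond.
- by move=> i; rewrite inE -leNgt.
Qed.

Lemma trop_trace_ge gamma (t : R) :
  trop_eigenvalues M gamma -> 0 < t ->
  trop_trace M #|[set i | t <= gamma i]| = \prod_(i | t <= gamma i) gamma i.
Proof.
(* The default [t / 2] keeps the left end of the gap positive. *)
move=> hg t0; pose a := \big[Num.max/t / 2]_(i | gamma i < t) gamma i.
rewrite (@trop_trace_gap gamma [set i | t <= gamma i] a t)//.
- by apply: eq_bigl => i; rewrite inE.
- by rewrite (@lt_le_trans _ _ (t / 2)) ?divr_gt0// bigmax_ge_id.
- by rewrite bigmax_lt// ltr_pdivrMr// ltr_pMr// ltr1n.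
- by move=> i; rewrite inE.
- by move=> i; rewrite inE -ltNge => it; exact: (bigmax_sup i).
Qed.

End TropicalRoots.

(** * Saturation and the product of the largest tropical eigenvalues *)

(** The logarithm of [P * t ^+ k] is affine in the offset [k], so concavity with weight [k / d]
    carries the bounds at the ends [u] and [u + d] over to [u + k]. *)
Lemma concave_log_interpolation (R : realType) (f : R -> \bar R)
    (u k d : nat) (P t : R) :
  concave_ereal f -> 0 < P -> 0 < t -> (0 < d)%N -> (k <= d)%N ->
  (lne P%:E <= f u%:R)%E -> (lne (P * t ^+ d)%:E <= f (u + d)%:R)%E ->
  ((P * t ^+ k)%:E <= expeR (f (u + k)%:R))%E.
Proof.
move=> cf P0 t0 d0 kd; have td0 := exprn_gt0 d t0; have tk0 := exprn_gt0 k t0.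
rewrite !lne_EFin ?mulr_gt0// => fu fv.
have dR : (d%:R : R) != 0 by rewrite pnatr_eq0 -lt0n.
pose th : R := k%:R / d%:R.
have th0 : 0 <= th by rewrite divr_ge0.
have th1 : 0 <= 1 - th by rewrite subr_ge0 ler_pdivrMr ?ltr0n// mul1r ler_nat.
have thd : th * d%:R = k%:R by rewrite divfK.
have := cf u%:R (u + d)%:R th; rewrite th0 -subr_ge0 th1 => /(_ isT).
have -> : (1 - th) * u%:R + th * (u + d)%:R = (u + k)%:R :> R.
  by rewrite !natrD mulrDr addrA -mulrDl subrK mul1r thd.
move=> cf_k; rewrite -[(P * _)%:E]lneK; last first.
  by rewrite in_itv/= leey andbT lee_fin mulr_ge0 ?ltW.
rewrite lne_EFin ?mulr_gt0// ler_expeR (le_trans _ cf_k)//.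
apply: (@le_trans _ _
  ((1 - th)%:E * (ln P)%:E + th%:E * (ln (P * t ^+ d))%:E)%E).
  rewrite -!EFinM -EFinD lee_fin !lnM ?posrE// !lnXn// mulrDr addrA -mulrDl.
  by rewrite subrK mul1r -[ln t *+ d]mulr_natl mulrA thd mulr_natl.
by apply: leeD; apply: lee_wpmul2l; rewrite ?lee_fin.
Qed.

Lemma prod_trop_eigenvalues_le (R : realType) (n k : nat) (M : 'M[R]_n)
    (gamma : 'I_n -> R) :
  trop_eigenvalues M gamma -> (1 <= k <= n)%N -> saturated M k ->
  \prod_(i < n | (i < k)%N) gamma i <= trop_trace M k.
Proof.
move=> hg /andP[k0 kn] [f [[[_ _ cf fM] _] fk]].
have [g0 gP _] := hg.
have kn' : (k.-1 < n)%N by rewrite prednK.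
(* Indices start at 0, so [gamma l] is the [k]-th tropical eigenvalue. If it is zero, so is the
   product. *)
pose l := Ordinal kn'; pose t := gamma l.
have := g0 l; rewrite le_eqVlt => /orP[/eqP tE|t0].
  by rewrite (bigD1 l) /= ?prednK// -tE mul0r trop_trace_ge0.
pose U := [set i | t < gamma i]; pose V := [set i | t <= gamma i].
pose K := [set i : 'I_n | (i < k)%N].
have UK : U \subset K.
  apply/fintype.subsetP => i; rewrite !inE ltnNge; apply: contraL => ki.
  by rewrite -leNgt gP//= (leq_trans (leq_pred _)).
have KV : K \subset V.
  by apply/fintype.subsetP => i; rewrite !inE => ik; rewrite gP//= -ltnS prednK.
have cK : #|K| = k by rewrite card_ord_lt.
have UsubV := fintype.subset_trans UK KV.
have lV : (#|U| < #|V|)%N.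
  apply: proper_card; apply/properP; split => //.
  by exists l; rewrite !inE /t ?lexx ?ltxx.
have lt_uk : (#|U| <= k)%N by rewrite -cK subset_leq_card.
(* On [V] outside [U] every [gamma i] equals [t]; the formula serves both [W = K] and [W = V]. *)
have prodW (W : {set 'I_n}) : U \subset W -> W \subset V ->
    \prod_(i in W) gamma i = \prod_(i in U) gamma i * t ^+ (#|W| - #|U|).
  move=> UW WV; rewrite (big_setID U) /= (finset.setIidPr UW); congr (_ * _).
  rewrite -(cardsDS UW) -prodr_const; apply: eq_bigr => i.
  rewrite finset.in_setD inE -leNgt => /andP[it /(fintype.subsetP WV)].
  by rewrite inE => ti; apply/le_anti; rewrite it ti.
have prodE (Q : pred 'I_n) :
    \prod_(i | Q i) gamma i = \prod_(i in [set i | Q i]) gamma i.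
  by apply: eq_bigl => i; rewrite inE.
have P0 : 0 < \prod_(i in U) gamma i.
  by apply: prodr_gt0 => i; rewrite inE; exact: lt_trans.
rewrite prodE prodW// cK -lee_fin -fk -[in leRHS](subnKC lt_uk).
apply: (@concave_log_interpolation _ _ _ _ (#|V| - #|U|)) => //.
- by rewrite subn_gt0.
- by rewrite leq_sub2r// -cK subset_leq_card.
- rewrite -prodE -(trop_trace_gt hg t0) fM//.
  by rewrite -[X in (_ <= X)%N]card_ord max_card.
- rewrite -prodW// -prodE -(trop_trace_ge hg t0) subnKC ?(ltnW lV)// fM//.
  by rewrite -[X in (_ <= X)%N]card_ord max_card.
Qed.

(** * Comparison of the two bounds on the sum of the principal minors *)

Theorem theorem14 (R : realType) (n k : nat) (A : 'M[R[i]]_n)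
    (lambda : 'I_n -> R[i]) (gamma : 'I_n -> R)
    (I : {set 'I_n}) (delta : R)
    (hlambda : ordered_eigenvalues A lambda)
    (hgamma : trop_eigenvalues (cmod_mx A) gamma)
    (hk : (1 <= k <= n)%N)
    (hsat : saturated (cmod_mx A) k)
    (hI : unique (attains_trop_trace (cmod_mx A) k) I)
    (hdet : \det (submatrix A I I) != 0)
    (hdelta_weight : forall (J : {set 'I_n}) (s : {perm 'I_n}),
        #|J| = k -> J <> I -> perm_on J s ->
        perm_weight (cmod_mx A) J s <= delta * trop_trace (cmod_mx A) k)
    (hdelta : (k < n)%N ->
        delta < cmod (\det (submatrix A I I)) /
          (trop_trace (cmod_mx A) k * ('C(n, k)%:R - 1) * (k`!)%:R)) :
  ('C(n, k)%:R)^-1 *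
    (cmod (\det (submatrix A I I)) / trop_trace (cmod_mx A) k
       - delta * ('C(n, k)%:R - 1) * (k`!)%:R) *
    \prod_(i < n | (i < k)%N) gamma i
  <= cmod (\prod_(i < n | (i < k)%N) lambda i).
Proof.
have [hchar hlam] := hlambda; have [k0 kn] := andP hk.
have [[Ik _] _] := hI.
set M := cmod_mx A; set T := trop_trace M k; set D := cmod _.
set C : R := 'C(n, k)%:R; set G := \prod_(i < n | _) gamma i.
set N : R := _%:R; set P := cmod (\prod_(i < n | _) lambda i).
have D0 : 0 < D.
  rewrite lt0r cmod_ge0 andbT; apply: contraNneq hdet => D0.
  by rewrite -normr_eq0 -cmodE -/D D0.
(* With [D > 0] this yields [T > 0], which justifies cancelling [T] later. *)
have DT : D <= T * N.
  rewrite /D det_submatrix /N -Ik; apply: cmod_principal_minor_le => s sI.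
  by rewrite /T -Ik; exact: perm_weight_le_trop_trace.
have N0 : 0 < N by rewrite ltr0n fact_gt0.
have T0 : 0 < T by rewrite -(pmulr_lgt0 _ N0) (lt_le_trans D0).
have C0 : 0 < C by rewrite ltr0n bin_gt0.
have G0 : 0 <= G by apply: prodr_ge0 => i _; case: hgamma.
have GT : G <= T by exact: prod_trop_eigenvalues_le.
have P0 : 0 <= P by exact: cmod_ge0.
have card_k : #|[pred J : {set 'I_n} | #|J| == k]| = 'C(n, k).
  by rewrite -cardsE card_draws card_ord.
(* Up to the sign [(-1) ^+ k], both sums are the coefficient of [X^(n-k)] in the characteristic
   polynomial. *)
have minor_sum : \sum_(J : {set 'I_n} | #|J| == k) principal_minor A J =
    \sum_(J : {set 'I_n} | #|J| == k) \prod_(i in J) lambda i.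
  apply: (can_inj (signrMK k)).
  by rewrite -coef_char_poly// hchar coef_prod_XsubC_sum.
have upper :
    cmod (\sum_(J : {set 'I_n} | #|J| == k) principal_minor A J) <= P * C.
  rewrite minor_sum (le_trans (cmod_sum _ _))//.
  rewrite /C -card_k mulr_natr -sumr_const ler_sum// => J /eqP Jk.
  rewrite /P !cmod_prod -Jk; apply: prod_decreasing_le => // i.
  exact: cmod_ge0.
have lower : D - (C - 1) * (delta * T * N) <=
    cmod (\sum_(J : {set 'I_n} | #|J| == k) principal_minor A J).
  rewrite lerBlDr (bigD1 I) ?Ik//=; set S := \sum_(J | _) _.
  have -> : D = cmod (principal_minor A I + S - S).
    by rewrite addrK -det_submatrix.
  rewrite (le_trans (cmodD _ _))// cmodN lerD2l.
  rewrite (le_trans (cmod_sum _ _))//.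
  have -> : C - 1 = \sum_(J : {set 'I_n} | (#|J| == k) && (J != I)) 1.
    by rewrite /C -card_k -sumr_const (bigD1 I) ?inE ?Ik//= addrAC subrr add0r.
  rewrite mulr_suml ler_sum// => J /andP[/eqP Jk /eqP JI]; rewrite mul1r.
  rewrite /N -Jk; apply: cmod_principal_minor_le => s.
  exact: hdelta_weight.
set L := D / T - _.
have LT : L * T <= P * C.
  apply: le_trans (le_trans lower upper).
  rewrite /L mulrBl divfK ?gt_eqF//.
  by rewrite !mulrA [delta * (C - 1)]mulrC [in leRHS]mulrAC.
(* Multiplying [G <= T] by [L] keeps the order only for [L >= 0]; for [L < 0] the left-hand side is
   at most 0, hence at most [P]. *)
have [L0|L0] := leP 0 L.
  rewrite -mulrA ler_pdivrMl// [C * P]mulrC (le_trans _ LT)//.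
  exact: ler_wpM2l.
rewrite (le_trans _ P0)// -mulrA mulr_ge0_le0 ?invr_ge0 ?(ltW C0)//.
exact: mulr_le0_ge0 (ltW L0) G0.
Qed.
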